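(* Let $q$ be a power of a prime $p$, let $\mathbb{F}=\mathbb{F}_q$ be the field with $q$ elements, let $C$ be a Cauchy code over $\mathbb{F}$ of length $q$ and dimension $k$ with $2\le k\le q-2$, and let $G$ be a group of order $q$. Then $C$ is a left $G$-code if and only if $C$ is permutation equivalent to the parity check extended narrow sense Reed-Solomon code (of dimension $k$ over $\mathbb{F}$) and $G$ is an elementary abelian $p$-group.
   Context: Let $\overline{\mathbb{F}}=\mathbb{F}\cup\{\infty\}$ be the projective line over $\mathbb{F}$, where $x\in\mathbb{F}$ is identified with $[x,1]$ and $\infty$ with $[1,0]$. Let $\varphi:\overline{\mathbb{F}}\to\mathbb{F}^2$, $\varphi(x)=(x,1)$ for $x\in\mathbb{F}$ and $\varphi(\infty)=(1,0)$. For a homogeneous polynomial $P\in\mathbb{F}[X,Y]$ and $z\in\overline{\mathbb{F}}$ put $P(z)=P(\varphi(z))$. Cauchy codes: given $1\le k<n$, $\alpha=(\alpha_1,\dots,\alpha_n)\in\overline{\mathbb{F}}^n$ without repeated entries, with set of entries $L_\alpha$, and a map $f:L_\alpha\to\mathbb{F}^*$, the $k$-dimensional Cauchy code with location vector $\alpha$ and scaling map $f$ is $$\mathcal{C}_k(\alpha,f)=\{(f(\alpha_1)P(\alpha_1),\dots,f(\alpha_n)P(\alpha_n)):P\in\mathbb{F}[X,Y]\text{ homogeneous of degree }k-1\}\subseteq\mathbb{F}^n.$$ The $k$-dimensional parity check extended narrow sense Reed-Solomon code is $\mathcal{C}_k(\overline{\alpha},1)$ with $\overline{\alpha}=(1,\xi,\xi^2,\dots,\xi^{q-2},0)$,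 where $\xi$ is a primitive element of $\mathbb{F}$ and $1$ denotes the constant map with value $1$. Let $E=\{e_1,\dots,e_n\}$ be the standard basis of $\mathbb{F}^n$; $S_n$ acts linearly on $\mathbb{F}^n$ by $\sigma(e_i)=e_{\sigma(i)}$. Two linear codes $C,C'\subseteq\mathbb{F}^n$ are permutation equivalent if $\sigma(C)=C'$ for some $\sigma\in S_n$. For a group $G$ of order $n$, a linear code $C\subseteq\mathbb{F}^n$ is a left $G$-code if there is a bijection $\phi:E\to G$ whose linear extension $\phi:\mathbb{F}^n\to\mathbb{F}G$ to the group algebra maps $C$ onto a left ideal of $\mathbb{F}G$. *)

(* Defs.v *)
From HB Require Import structures.
From mathcomp Require Import all_boot all_order all_algebra all_fingroup.
From mathcomp Require Import all_solvable all_character.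
From mathcomp Require Export mpoly.

Set Implicit Arguments.
Unset Strict Implicit.
Unset Printing Implicit Defensive.

Import GRing.Theory.
Local Open Scope ring_scope.

Section Codes.

Variable F : finFieldType.

(* The projective line over F is [option F], with [None] the point at
   infinity; its representatives are phi(x) = (x, 1) and phi(oo) = (1, 0). *)
Definition proj_rep (x : option F) : 2.-tuple F :=
  if x is Some a then [tuple a; 1] else [tuple 1; 0].

Definition proj_eval (P : {mpoly F[2]}) (x : option F) : F :=
  P.@[tnth (proj_rep x)].

Definition cauchy_word (d n : nat) (alpha : n.-tuple (option F))
    (f : option F -> F) (P : dhomog 2 F d) : 'rV[F]_n :=
  \row_i (f (tnth alpha i) * proj_eval P (tnth alpha i)).

Fact cauchy_word_is_linear d n (alpha : n.-tuple (option F)) f :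
  linear (@cauchy_word d n alpha f).
Proof.
move=> a P Q; apply/rowP=> i; rewrite !mxE /proj_eval /= mevalD mevalZ.
by rewrite mulrDr mulrCA.
Qed.

HB.instance Definition _ d n alpha f :=
  GRing.isLinear.Build F (dhomog 2 F d) 'rV[F]_n _ (@cauchy_word d n alpha f)
    (@cauchy_word_is_linear d n alpha f).

Definition cauchy_code (k n : nat) (alpha : n.-tuple (option F))
    (f : option F -> F) : {vspace 'rV[F]_n} :=
  limg (linfun (@cauchy_word k.-1 n alpha f)).

Lemma cauchy_codeP k n (alpha : n.-tuple (option F)) f (c : 'rV[F]_n) :
  reflect (exists2 P : {mpoly F[2]}, P \is k.-1.-homog &
             c = \row_i (f (tnth alpha i) * proj_eval P (tnth alpha i)))
          (c \in cauchy_code k alpha f).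
Proof.
apply: (iffP memv_imgP) => [[P _ ->] | [P homP ->]].
  by exists (mpoly_of_dhomog P); [case: P | rewrite lfunE].
by exists (DHomog homP); rewrite ?memvf ?lfunE.
Qed.

(* The scaling map is only constrained on the entries of [alpha]: its values
   elsewhere do not affect the code. *)
Definition is_cauchy_code (k n : nat) (C : {vspace 'rV[F]_n}) : Prop :=
  (1 <= k < n)%N /\
  exists (alpha : n.-tuple (option F)) (f : option F -> F),
    [/\ uniq alpha, forall x, x \in alpha -> f x != 0
      & C = cauchy_code k alpha f].

(* (1, xi, xi^2, ..., xi^(n-2), 0), to be used with n = #|F|. *)
Definition ext_rs_loc (n : nat) (xi : F) : n.-tuple (option F) :=
  [tuple Some (if (i < n.-1)%N then xi ^+ i else 0) | i < n].

Definition ext_rs_code (k n : nat) (xi : F) : {vspace 'rV[F]_n} :=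
  cauchy_code k (ext_rs_loc n xi) (fun=> 1).

(* Right multiplication by [perm_mx s] sends e_i to e_(s i). *)
Definition perm_equivalent (n : nat) (C D : {vspace 'rV[F]_n}) : Prop :=
  exists s : 'S_n, (linfun (mulmxr (perm_mx s)) @: C)%VS = D.

Section GroupCodes.

Variables (gT : finGroupType) (G : {group gT}).

(* The group algebra FG is the library's [group_ring F G], the algebra of
   #|G| x #|G| matrices with basis [regular_repr F G g] for g in G; these
   satisfy [regular_repr F G (g * h)] = [regular_repr F G g *m
   regular_repr F G h] on G, so the order of products is preserved. *)
Definition group_code_map (n : nat) (phi : 'I_n -> gT) (c : 'rV[F]_n) :
    'M[F]_#|G| :=
  \sum_i c 0 i *: regular_repr F G (phi i).

Fact group_code_map_is_linear n (phi : 'I_n -> gT) :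
  linear (group_code_map phi).
Proof.
move=> a c d; rewrite /group_code_map scaler_sumr -big_split /=.
by apply: eq_bigr => i _; rewrite !mxE scalerDl scalerA.
Qed.

HB.instance Definition _ n phi :=
  GRing.isLinear.Build F 'rV[F]_n 'M[F]_#|G| _ (@group_code_map n phi)
    (@group_code_map_is_linear n phi).

Definition is_left_ideal (I : {vspace 'M[F]_#|G|}) : Prop :=
  (forall B, B \in I -> (B \in group_ring F G)%MS) /\
  (forall A B, (A \in group_ring F G)%MS -> B \in I -> A *m B \in I).

Definition left_group_code (n : nat) (C : {vspace 'rV[F]_n}) : Prop :=
  exists phi : 'I_n -> gT,
    [/\ injective phi, [set phi i | i : 'I_n] = G
      & is_left_ideal (linfun (group_code_map phi) @: C)%VS].

End GroupCodes.

End Codes.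

(* Main.v *)
(* Moving the missing point of the projective line to infinity turns C into a
   generalized Reed-Solomon code with location set F and multipliers w. The
   polynomials of degree k - 1 vanishing on k - 1 prescribed points are unique
   up to a scalar; comparing two of them with k - 2 common roots shows that a
   permutation automorphism s of C preserves cross-ratios, and since s permutes
   F it must then be affine.
   A left G-code structure is a regular action of G by such automorphisms. The
   slopes form a homomorphism from G to the units of F, trivial because
   |G| = |F|; so G acts by all translations, whence G embeds in (F, +), and
   translation invariance of C forces w to be constant. Conversely, univariate
   polynomials of bounded degree are stable under translations. *)

Require Import Defs.
From mathcomp Require Import all_boot all_order all_algebra all_fingroup.
From mathcomp Require Import all_solvable all_character all_field.
From mathcomp Require Import ring zify.

Set Implicit Arguments.
Unset Strict Implicit.
Unset Printing Implicit Defensive.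

Import GRing.Theory FinRing.Theory.
Local Open Scope ring_scope.

Lemma poly_eq_scale_prod_XsubC (R : fieldType) (Q : {poly R}) (rs : seq R) :
    (size Q <= (size rs).+1)%N -> all (root Q) rs -> uniq rs ->
  exists c, Q = c *: \prod_(a <- rs) ('X - a%:P).
Proof.
rewrite -uniq_rootsE => sQ rQ u_rs.
have [S defQ] := uniq_roots_prod_XsubC rQ u_rs.
have [S0|nzS] := eqVneq S 0; first by exists 0; rewrite scale0r defQ S0 mul0r.
have mP : \prod_(a <- rs) ('X - a%:P) \is monic by apply: monic_prod_XsubC.
have sS : (size S <= 1)%N.
  move: sQ; rewrite defQ size_Mmonic // size_prod_XsubC addnS /=.
  by rewrite -(add1n (size rs)) leq_add2r.
by exists S`_0; rewrite defQ {1}[S]size1_polyC // mul_polyC.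
Qed.

(** * Permutation automorphisms of generalized Reed-Solomon codes *)

Section GRSAutomorphisms.

Variables (F : finFieldType) (k : nat) (w : F -> F).

(* Words of the generalized Reed-Solomon code with location set F and
   multipliers w are seen as functions x |-> w x * Q.[x] on F; the condition
   says that precomposition with s preserves the code. *)
Definition grs_aut (s : F -> F) :=
  forall Q : {poly F}, (size Q <= k)%N ->
  exists2 Q' : {poly F}, (size Q' <= k)%N &
    forall x, w (s x) * Q.[s x] = w x * Q'.[x].

Hypothesis w_neq0 : forall x, w x != 0.

(** Fix a set [A] of [k - 2] further points. A word vanishing at [s c] and on the image of [A] pulls
    back to one vanishing at [c] and on [A], which is unique up to a scalar. For [c = a, b],
    evaluated at [x, y], the scalars, multipliers and products over [A] occur alike on both
    sides. *)
Lemma grs_aut_cross_ratio s a b x y :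
    (2 <= k <= #|F| - 2)%N -> injective s -> grs_aut s ->
    uniq [:: a; b; x; y] ->
  (s x - s a) * (s y - s b) * ((x - b) * (y - a)) =
  (s x - s b) * (s y - s a) * ((x - a) * (y - b)).
Proof.
move=> /andP[k_ge2 k_le] s_inj aut_s u_abxy.
(* The bound [k <= #|F| - 2] leaves room for [k - 2] points besides the four given ones. *)
pose A := take (k - 2) (enum [predC [:: a; b; x; y]]).
have szA : size A = (k - 2)%N.
  rewrite size_takel // -cardE.
  have := cardC (mem [:: a; b; x; y]); rewrite (card_uniqP u_abxy) /= => cF.
  by apply: (@leq_trans (#|F| - 4)%N); [lia | rewrite -cF addKn].
have uA : uniq A by rewrite take_uniq ?enum_uniq.
have notA z : z \in [:: a; b; x; y] -> z \notin A.
  by move=> zs; apply: contraL zs => /mem_take; rewrite mem_enum.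
have word c : c \notin A -> exists d, forall z,
    w (s z) * ((s z - s c) * \prod_(e <- A) (s z - s e))
    = w z * (d * ((z - c) * \prod_(e <- A) (z - e))).
  move=> cA.
  pose P := \prod_(e <- map s (c :: A)) ('X - e%:P).
  have szP : (size P <= k)%N.
    rewrite size_prod_XsubC size_map /= szA.
    by case: (k) k_ge2 => [|[|?]] //; rewrite subn2.
  have [Q szQ defQ] := aut_s _ szP.
  have hP z : P.[s z] = (s z - s c) * \prod_(e <- A) (s z - s e).
    by rewrite horner_prod /= big_cons big_map hornerXsubC; congr (_ * _);
       apply: eq_bigr => e _; rewrite hornerXsubC.
  have [|||d defd] := @poly_eq_scale_prod_XsubC _ Q (c :: A).
  - by rewrite /= szA; case: (k) k_ge2 szQ => [|[|?]] //; rewrite subn2.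
  - apply/allP=> z zcA; rewrite rootE; apply/eqP/(mulfI (w_neq0 z)).
    rewrite -defQ mulr0; apply/eqP; rewrite mulf_eq0 -/(root _ _).
    by rewrite root_prod_XsubC map_f ?orbT.
  - by rewrite /= cA.
  exists d => z; rewrite -hP defQ defd hornerZ horner_prod big_cons hornerXsubC.
  by do 3!congr (_ * _); apply: eq_bigr => e _; rewrite hornerXsubC.
have prod_neq0 z : z \notin A -> \prod_(e <- A) (s z - s e) != 0.
  move=> zA; rewrite prodf_seq_neq0; apply/allP=> e eA /=.
  by rewrite subr_eq0 (inj_eq s_inj); apply: contraNneq zA => ->.
have [da Ha] := word a (notA a (mem_head _ _)).
have [|db Hb] := word b; first by rewrite notA ?inE ?eqxx ?orbT.
move: (prod_neq0 x) (prod_neq0 y) (Ha x) (Ha y) (Hb x) (Hb y).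
rewrite !notA ?inE ?eqxx ?orbT // => /(_ isT) + /(_ isT).
move: (w_neq0 (s x)) (w_neq0 (s y)).
set Rx := \prod_(e <- A) (s x - s e); set Ry := \prod_(e <- A) (s y - s e).
set Sx := \prod_(e <- A) (x - e); set Sy := \prod_(e <- A) (y - e).
move=> wx wy nzRx nzRy ax ay bx by_.
apply: (mulfI (mulf_neq0 (mulf_neq0 wx nzRx) (mulf_neq0 wy nzRy))).
transitivity ((w (s x) * ((s x - s a) * Rx)) * (w (s y) * ((s y - s b) * Ry))
   * ((x - b) * (y - a))); first by ring.
transitivity ((w (s x) * ((s x - s b) * Rx)) * (w (s y) * ((s y - s a) * Ry))
   * ((x - a) * (y - b))); last by ring.
by rewrite ax ay bx by_; ring.
Qed.

Lemma grs_aut_affine s :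
    (2 <= k <= #|F| - 2)%N -> injective s -> grs_aut s ->
  forall x, s x = (s 1 - s 0) * x + s 0.
Proof.
move=> k_bounds s_inj aut_s y.
have [->|y0] := eqVneq y 0; first by ring.
have [->|y1] := eqVneq y 1; first by ring.
have s01 : s 0 != s 1 by rewrite (inj_eq s_inj) eq_sym oner_neq0.
pose u := s y - s 0; pose v := s y - s 1.
have u0 : u != 0 by rewrite subr_eq0 (inj_eq s_inj).
have v0 : v != 0 by rewrite subr_eq0 (inj_eq s_inj).
(* [D] is the deviation of [s y] from the affine formula, so [D = 0] is the desired case. *)
pose D := v * y - u * (y - 1).
have [D0|nzD] := eqVneq D 0.
  by apply/eqP; rewrite -subr_eq0; apply/eqP; rewrite -[RHS]D0 /D /u /v; ring.
(* Let c be the constant ratio of (s x - s 0) / (s x - s 1) to x / (x - 1). If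
   c were not 1, x = 1 / (1 - c) would give s x - s 0 = s x - s 1; this x is
   the quotient below. *)
pose x := v * y / D.
have xD : x * D = v * y by rewrite /x mulfVK.
have x1D : (x - 1) * D = u * (y - 1) by rewrite mulrBl xD mul1r /D; ring.
have y1' : y - 1 != 0 by rewrite subr_eq0.
have x0 : x != 0 by rewrite !mulf_neq0 ?invr_neq0.
have x1 : x != 1.
  rewrite -subr_eq0; apply: contra_eq_neq x1D => ->.
  by rewrite mul0r eq_sym mulf_neq0.
(* The cross-ratio identity needs four distinct points; [x = y] would give [u = v], that is
   [s 0 = s 1]. *)
have [xy|xy] := eqVneq x y.
  move: xD x1D; rewrite xy mulrC => /(mulIf y0) -> /eqP.
  rewrite mulrC (inj_eq (mulIf y1')) /u /v => /eqP/addrI/oppr_inj/eqP.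
  by rewrite eq_sym (negPf s01).
have /= := @grs_aut_cross_ratio s 0 1 x y k_bounds s_inj aut_s.
rewrite !inE !negb_or (eq_sym 0 1) oner_neq0 ![_ == x]eq_sym ![_ == y]eq_sym.
rewrite x0 x1 y0 y1 [y == x]eq_sym xy => /(_ isT); rewrite !subr0 -/u -/v => E.
have : (s x - s 0) * (v * u * y * (y - 1)) =
       (s x - s 1) * (v * u * y * (y - 1)).
  transitivity ((s x - s 0) * v * ((x - 1) * D * y)).
    by rewrite x1D; ring.
  transitivity (((s x - s 0) * v * ((x - 1) * y)) * D); first by ring.
  rewrite E; transitivity ((s x - s 1) * u * (x * D * (y - 1))); first by ring.
  by rewrite xD; ring.
move/(mulIf (mulf_neq0 (mulf_neq0 (mulf_neq0 v0 u0) y0) y1')).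
by move/addrI/oppr_inj/eqP; rewrite (negPf s01).
Qed.

Lemma finField_mulrn_card (x : F) : x *+ #|F| = 0.
Proof. by rewrite -zmodXgE -cardsT expg_cardG ?inE. Qed.

(** The word of the constant 1 yields [w (x + b) = w x * H.[x]]. A degree count forces [H] to be
    constant, and iterating the translation shows that this constant is 1. *)
Lemma grs_aut_translation b :
  (0 < k < #|F|)%N -> grs_aut (fun x => x + b) -> forall x, w (x + b) = w x.
Proof.
move=> /andP[k_gt0 k_lt] aut_b.
have [|H szH defH] := aut_b 1; first by rewrite size_poly1.
have nzH : H != 0.
  have := defH 0; rewrite !hornerE; apply: contra_eq_neq => ->.
  by rewrite horner0 mulr0 ?mulr1 w_neq0.
have szH1 : (size H <= 1)%N.
  rewrite leqNgt; apply/negP=> szH_gt1.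
  (* The exponent is chosen so that [P] below has degree exactly [k]. [P] and [Q] agree on [F], and
     [P - Q] has size at most [k.+1 <= #|F|], so they would be equal although [Q] has degree below
     [k]. *)
  have [|Q szQ defQ] := aut_b 'X^(k - (size H).-1).
    by rewrite size_polyXn; lia.
  pose P := H * ('X - (- b)%:P) ^+ (k - (size H).-1).
  have szP : size P = k.+1.
    by rewrite size_Mmonic ?monic_exp ?monicXsubC // size_exp_XsubC; lia.
  have : P - Q = 0.
    apply: (@roots_geq_poly_eq0 _ _ (enum F)); rewrite ?enum_uniq //.
      apply/allP=> x _; rewrite rootE !hornerE subr_eq0; apply/eqP.
      apply: (mulfI (w_neq0 x)); rewrite -defQ mulrA -defH.
      by rewrite !hornerE opprK.
    rewrite -cardE; apply: leq_trans k_lt; apply: leq_trans (size_polyD _ _) _.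
    by rewrite size_polyN geq_max szP leqnn leqW.
  by move/eqP; rewrite subr_eq0 => /eqP PQ; move: szQ; rewrite -PQ szP ltnn.
have wb x : w (x + b) = H`_0 * w x.
  by have := defH x; rewrite (size1_polyC szH1) !hornerE mulrC coefC.
(* Iterating #|F| times multiplies by H`_0 ^+ #|F| = H`_0. *)
have wn n x : w (x + b *+ n) = H`_0 ^+ n * w x.
  elim: n => [|n IHn]; first by rewrite addr0 mul1r.
  by rewrite mulrSr addrA wb IHn exprS mulrA.
move=> x; have := wn #|F| 0; rewrite finField_mulrn_card addr0 expf_card.
by rewrite -{1}[w 0]mul1r => /(mulIf (w_neq0 0)) H1; rewrite wb -H1 mul1r.
Qed.

End GRSAutomorphisms.

(** * Regular groups of automorphisms *)

Section RegularAutomorphisms.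

Variables (F : finFieldType) (k p : nat) (w : F -> F).
Variables (gT : finGroupType) (G : {group gT}) (s : gT -> F -> F).

(** Injectivity of [g |-> s g 0] and [#|G| = #|F|] make the action regular. Once every [s g] is a
    translation, this map embeds [G] into the additive group of [F]; it is also onto, so [w] is
    invariant under all translations. *)
Lemma grs_aut_regular :
    prime p -> p \in [pchar F] -> (2 <= k <= #|F| - 2)%N ->
    (forall x, w x != 0) -> #|G| = #|F| ->
    {in G &, forall g h x, s (g * h)%g x = s g (s h x)} ->
    s 1%g =1 id -> {in G &, injective (fun g => s g 0)} ->
    {in G, forall g, grs_aut k w (s g)} ->
  (p.-abelem G)%g /\ forall x y, w x = w y.
Proof.
move=> p_pr pF k_bounds w0 cardG sM s1 s0_inj autG.
have s_inj g : g \in G -> injective (s g).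
  move=> Gg x y /(congr1 (s g^-1%g)).
  by rewrite -!sM ?groupV // mulVg !s1.
have affG g : g \in G -> forall x, s g x = (s g 1 - s g 0) * x + s g 0.
  by move=> Gg; apply: (grs_aut_affine w0 k_bounds (s_inj g Gg) (autG g Gg)).
have slopeX g n : g \in G ->
    s (g ^+ n)%g 1 - s (g ^+ n)%g 0 = (s g 1 - s g 0) ^+ n.
  move=> Gg; elim: n => [|n IHn]; first by rewrite !s1 subr0.
  rewrite expgS !sM ?groupX // !(affG g Gg (s _ _)) exprS -IHn; ring.
(* The slope a of s g satisfies a = a ^+ #|F| = a ^+ #|G| = 1. *)
have tr g x : g \in G -> s g x = x + s g 0.
  move=> Gg; have := slopeX g #|F| Gg.
  rewrite expf_card -cardG expg_cardG // !s1 subr0 => slope1.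
  by rewrite (affG g Gg x) -slope1 mul1r.
have s0M g h : g \in G -> h \in G -> s (g * h)%g 0 = s g 0 + s h 0.
  by move=> Gg Gh; rewrite sM // (tr g) // addrC.
split.
  apply/abelemP=> //; split.
    apply/centsP=> g Gg h Gh; apply: s0_inj; rewrite ?groupM //.
    by rewrite !s0M // addrC.
  move=> g Gg; apply: s0_inj; rewrite ?groupX //.
  have s0X n : s (g ^+ n)%g 0 = s g 0 *+ n.
    elim: n => [|n IHn]; first by rewrite s1.
    by rewrite expgS s0M ?groupX // IHn mulrS.
  by rewrite s0X s1 -mulr_natr (pcharf0 pF) mulr0.
have surj b : exists2 g, g \in G & s g 0 = b.
  have /setP/(_ b) : [set s g 0 | g in G] = setT.
    by apply/eqP; rewrite eqEcard subsetT cardsT card_in_imset ?cardG /=.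
  by rewrite inE => /imsetP[g Gg ->]; exists g.
have w_const x : w x = w 0.
  have [g Gg <-] := surj x; rewrite -[s g 0]add0r.
  apply: (grs_aut_translation w0 (k := k)); first by lia.
  move=> Q /(autG g Gg)[Q' sQ' defQ]; exists Q' => // y.
  by rewrite -tr.
by move=> x y; rewrite w_const (w_const y).
Qed.

End RegularAutomorphisms.

(** * Left group codes in terms of coordinate permutations *)

Section GroupCodes.

Variables (F : finFieldType) (gT : finGroupType) (G : {group gT}) (n : nat).

Lemma group_code_map_inj (phi : 'I_n -> gT) :
    injective phi -> (forall i, phi i \in G) ->
  injective (group_code_map (F := F) G phi).
Proof.
move=> phi_inj phiG c d; rewrite /group_code_map => eq_cd.
apply/rowP=> j; move/(congr1 (@gring_proj F _ G (phi j))): eq_cd.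
rewrite !linear_sum /=.
have sumE (e : 'rV[F]_n) :
    \sum_i @gring_proj F _ G (phi j) (e 0 i *: regular_repr F G (phi i))
    = (e 0 j)%:M.
  rewrite (bigD1 j) //= big1 ?addr0 => [|i ij].
    by rewrite linearZ /= gring_projE // eqxx scalemx1.
  rewrite linearZ /= gring_projE // (inj_eq phi_inj) eq_sym (negPf ij).
  exact: scaler0.
by rewrite !sumE => /(congr1 (fun M : 'M_1 => M 0 0)); rewrite !mxE !mulr1n.
Qed.

(** Left multiplication by [g] carries the basis element at position [i] to the one at [s i], so it
    undoes the reindexing of [c] by [s]. *)
Lemma group_code_map_permuted (phi : 'I_n -> gT) (s : 'I_n -> 'I_n) g
    (c : 'rV[F]_n) :
    injective phi -> (forall i, phi i \in G) -> g \in G ->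
    (forall i, phi (s i) = (g * phi i)%g) ->
  regular_repr F G g *m group_code_map G phi (\row_i c 0 (s i)) =
  group_code_map G phi c.
Proof.
move=> phi_inj phiG Gg sE; rewrite /group_code_map mulmx_sumr.
have s_inj : injective s.
  by move=> i j /(congr1 phi); rewrite !sE => /mulgI/phi_inj.
rewrite [RHS](reindex_inj s_inj) /=; apply: eq_bigr => i _.
by rewrite mxE sE repr_mxM // scalemxAr.
Qed.

(** The elements of [G] span the group algebra, so a subspace of it is a left ideal once it is
    stable under left multiplication by [G]. Read through [phi], these multiplications permute the
    positions. *)
Lemma left_group_codeP (C : {vspace 'rV[F]_n}) :
  left_group_code G C <->
  exists phi : 'I_n -> gT,
    [/\ injective phi, [set phi i | i : 'I_n] = G
      & forall g s, g \in G -> (forall i, phi (s i) = (g * phi i)%g) ->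
        forall c, c \in C -> \row_i c 0 (s i) \in C].
Proof.
split=> -[phi [phi_inj defG phiC]]; exists phi; split=> //.
  have phiG i : phi i \in G by rewrite -defG imset_f.
  case: phiC => _ idC g s Gg sE c Cc.
  have := memv_img (linfun (group_code_map G phi)) Cc.
  rewrite lfunE /= -(group_code_map_permuted c phi_inj phiG Gg sE).
  move/(idC (regular_repr F G g^-1%g)).
  rewrite mulmxA -repr_mxM ?groupV // mulVg repr_mx1 mul1mx.
  have /[swap]/[apply] : (regular_repr F G g^-1%g \in group_ring F G)%MS.
    by rewrite envelop_mx_id ?groupV.
  case/memv_imgP=> d Cd; rewrite lfunE /= => /group_code_map_inj -> //.
have phiG i : phi i \in G by rewrite -defG imset_f.
split=> [B /memv_imgP[c _ ->]|A B /envelop_mxP[a ->] /memv_imgP[c Cc ->]].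
  rewrite lfunE /=; apply/envelop_mxP.
  exists (fun g => \sum_(i | phi i == g) c 0 i).
  rewrite /group_code_map (partition_big phi (mem G)) //=.
  apply: eq_bigr => g _.
  by rewrite scaler_suml; apply: eq_bigr => i /eqP ->.
rewrite mulmx_suml; apply: memv_suml => g Gg; rewrite -scalemxAl memvZ //.
(* Reindexing by the permutation of an element amounts to multiplying by its inverse, hence [g^-1]
   here. *)
have /fin_all_exists[s sE] i : exists j, phi j = (g^-1 * phi i)%g.
  have /imsetP[j _ ->] : (g^-1 * phi i)%g \in [set phi i | i : 'I_n].
    by rewrite defG groupM ?groupV.
  by exists j.
have := group_code_map_permuted c phi_inj phiG (groupVr Gg) sE.
rewrite lfunE /= => <-.
rewrite mulmxA -repr_mxM ?groupV // mulgV repr_mx1 mul1mx.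
by rewrite -(lfunE (group_code_map G phi)) memv_img // (phiC g^-1%g) ?groupV.
Qed.

End GroupCodes.

(** * Cauchy codes of length [#|F|] as generalized Reed-Solomon codes *)

Section CauchyCodes.

Variables (F : finFieldType) (k n : nat).

(** Value at [z] of the degree [d] homogenization of [Q]: at infinity only the monomial [X^d]
    survives. *)
Definition hom_eval d (Q : {poly F}) (z : option F) : F :=
  if z is Some a then Q.[a] else Q`_d.

Lemma homog_proj_eval d (P : {mpoly F[2]}) : P \is d.-homog ->
  exists2 Q : {poly F}, (size Q <= d.+1)%N &
    forall z, proj_eval P z = hom_eval d Q z.
Proof.
move=> /dhomogP homP.
exists (\sum_(m <- msupp P) P@_m *: 'X^(m ord0)).
  apply: (leq_trans (size_sum _ _ _)); apply/bigmax_leqP_seq => m mP _.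
  apply: leq_trans (size_scale_leq _ _) _; rewrite size_polyXn ltnS.
  by rewrite -(homP m mP) /= mdegE big_ord_recl leq_addr.
have degm m : m \in msupp P -> (m ord0 + m ord_max = d)%N.
  move=> mP; rewrite -(homP m mP) /= mdegE big_ord_recl big_ord1.
  by congr (_ + m _)%N; apply: val_inj.
case=> [a|]; rewrite /proj_eval mevalE /hom_eval ?horner_sum ?coef_sum;
  apply: eq_big_seq => m mP; rewrite big_ord_recl big_ord1.
  by rewrite !hornerE /= expr1n mulr1.
rewrite /= expr1n mul1r coefZ coefXn; congr (_ * _).
have -> : lift ord0 (@ord0 0) = ord_max by apply: val_inj.
rewrite -(degm m mP) expr0n.
by rewrite -{2}[m ord0]addn0 eqn_add2l.
Qed.

Lemma poly_homogenize d (Q : {poly F}) : (size Q <= d.+1)%N ->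
  exists2 P : {mpoly F[2]}, P \is d.-homog &
    forall z, proj_eval P z = hom_eval d Q z.
Proof.
move=> szQ.
exists (\sum_(j < d.+1) Q`_j *: ('X_ord0 ^+ j * 'X_ord_max ^+ (d - j))).
  apply: rpred_sum => j _; apply: dhomogZ.
  rewrite -[X in X.-homog](subnKC (ltnSE (ltn_ord j))).
  rewrite -[X in (X + _).-homog]mul1n -[X in (_ + X).-homog]mul1n.
  by apply: dhomogM; apply: dhomogMn; rewrite dhomogX /= mdeg1.
case=> [a|]; rewrite /proj_eval /hom_eval raddf_sum /=.
  rewrite (horner_coef_wide _ szQ); apply: eq_bigr => j _.
  by rewrite mevalZ rmorphM !rmorphXn /= !mevalXU /= expr1n mulr1.
rewrite big_ord_recr big1 /= ?add0r => [|j _].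
  by rewrite mevalZ rmorphM !rmorphXn /= !mevalXU /= subnn expr1n !mulr1.
rewrite mevalZ rmorphM !rmorphXn /= !mevalXU /= expr0n subn_eq0 leqNgt.
by rewrite ltn_ord !mulr0.
Qed.

Lemma mem_cauchy_code (alpha : n.-tuple (option F)) f c : (0 < k)%N ->
  c \in cauchy_code k alpha f <->
  exists2 Q : {poly F}, (size Q <= k)%N &
    c = \row_i (f (tnth alpha i) * hom_eval k.-1 Q (tnth alpha i)).
Proof.
move=> k_gt0; split=> [/cauchy_codeP[P homP ->]|[Q szQ ->]].
  have [Q szQ PQ] := homog_proj_eval homP; rewrite prednK // in szQ.
  by exists Q => //; apply/rowP=> i; rewrite !mxE PQ.
rewrite -{1}(prednK k_gt0) in szQ; have [P homP PQ] := poly_homogenize szQ.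
by apply/cauchy_codeP; exists P => //; apply/rowP=> i; rewrite !mxE PQ.
Qed.

Definition is_grs (C : {vspace 'rV[F]_n}) (b v : 'I_n -> F) :=
  forall c, c \in C <->
  exists2 Q : {poly F}, (size Q <= k)%N & c = \row_i (v i * Q.[b i]).

(** Translations fix infinity and, as [X + a] is monic, they also keep the value of [hom_eval d]
    there. *)
Lemma coef_comp_XaddC (Q : {poly F}) a d :
  (size Q <= d.+1)%N -> (Q \Po ('X + a%:P))`_d = Q`_d.
Proof.
move=> szQ; have szX : size ('X + a%:P : {poly F}) = 2 by rewrite size_XaddC.
have szc : size (Q \Po ('X + a%:P)) = size Q by apply: size_comp_poly2.
move: szQ; rewrite leq_eqVlt => /predU1P[szQ|szQ]; last first.
  by rewrite !nth_default ?szc.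
have := @lead_coef_comp _ Q ('X + a%:P); rewrite szX /lead_coef szc szQ /=.
by move=> ->; rewrite // -/(lead_coef _) lead_coefXaddC expr1n mulr1.
Qed.

(** The reciprocal polynomial in degree [d]: it exchanges X and Y in the homogenization, matching
    [t |-> 1 / t] on the projective line. *)
Definition rev_poly d (Q : {poly F}) : {poly F} := \poly_(j < d.+1) Q`_(d - j).

Lemma rev_polyK d (Q : {poly F}) :
  (size Q <= d.+1)%N -> rev_poly d (rev_poly d Q) = Q.
Proof.
move=> szQ; apply/polyP=> j; rewrite !coef_poly.
case: ltnP => [jd|dj]; last by rewrite nth_default // (leq_trans szQ).
by rewrite ltnS leq_subr subKn.
Qed.

Lemma horner_rev_poly d (Q : {poly F}) t :
  (size Q <= d.+1)%N -> t != 0 -> (rev_poly d Q).[t] = t ^+ d * Q.[t^-1].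
Proof.
move=> szQ t0; rewrite horner_poly (horner_coef_wide _ szQ) mulr_sumr.
rewrite (reindex_inj rev_ord_inj) /=; apply: eq_bigr => j _.
have jd : (j <= d)%N by rewrite -ltnS.
by rewrite subSS subKn // mulrCA exprB ?unitfE // exprVn.
Qed.

(** The projective line has [#|F| + 1] points, so [alpha] misses exactly one. Moving it to infinity
    preserves the space of homogeneous polynomials, and the factors that arise go into the
    multipliers. *)
Lemma cauchy_code_grs (alpha : n.-tuple (option F)) f :
    (0 < k)%N -> n = #|F| -> uniq alpha ->
    (forall x, x \in alpha -> f x != 0) ->
  exists b v, [/\ injective b, forall i, v i != 0
    & is_grs (cauchy_code k alpha f) b v].
Proof.
move=> k_gt0 nF u_alpha f0.
have alpha_inj : injective (tnth alpha) by apply/tuple_uniqP.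
have f0i i : f (tnth alpha i) != 0 by rewrite f0 ?mem_tnth.
have [z zP] : exists z, z \notin alpha.
  apply/existsP; apply: contraPT isT; rewrite negb_exists => /forallP all_alpha.
  have : (#|{: option F}| <= size alpha)%N.
    rewrite -(card_uniqP u_alpha); apply/subset_leq_card/subsetP=> x _.
    by have := all_alpha x; rewrite negbK.
  by rewrite card_option size_tuple nF ltnn.
have neqz i : tnth alpha i != z.
  by apply: contraNneq zP => <-; apply: mem_tnth.
case: z {zP} neqz => [e|] neqz; last first.
  pose b i := odflt 0 (tnth alpha i).
  have bE i : tnth alpha i = Some (b i).
    by move: (neqz i); rewrite /b; case: (tnth alpha i).
  exists b, (fun i => f (tnth alpha i)); split=> //.
    by move=> i j bij; apply: alpha_inj; rewrite !bE bij.
  move=> c; rewrite mem_cauchy_code //.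
  by split=> -[Q szQ ->]; exists Q => //; apply/rowP=> i; rewrite !mxE bE.
(* The projective transformation x |-> 1 / (x - e) moves the missing point e
   to infinity. *)
pose h (z : option F) := if z is Some a then (a - e)^-1 else 0.
pose u (z : option F) := if z is Some a then (a - e) ^+ k.-1 else 1.
have ae i a : tnth alpha i = Some a -> a - e != 0.
  move=> ai; rewrite subr_eq0; apply: contraNneq (neqz i) => <-.
  by rewrite ai.
(* The factor [(a - e) ^+ k.-1] clears the denominators of the reversed polynomial at [(a - e)^-1].
   At infinity [h] is 0, where the reversed polynomial takes the value of the coefficient of [S] in
   degree [k.-1]. *)
have evalE (S : {poly F}) i : (size S <= k)%N ->
    u (tnth alpha i) * (rev_poly k.-1 S).[h (tnth alpha i)] =
    hom_eval k.-1 (S \Po ('X + (- e)%:P)) (tnth alpha i).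
  move=> szS; rewrite -{1}(prednK k_gt0) in szS.
  rewrite /u /h /hom_eval; case E : (tnth alpha i) => [a|].
    rewrite horner_rev_poly ?invr_eq0 ?(ae i) // invrK mulrA -exprMn.
    by rewrite divff ?(ae i) // expr1n mul1r horner_comp !hornerE.
  by rewrite mul1r coef_comp_XaddC // horner_coef0 coef_poly subn0.
exists (fun i => h (tnth alpha i)).
exists (fun i => f (tnth alpha i) * u (tnth alpha i)).
split=> [i j|i|c].
- move=> hij; apply: alpha_inj; move: hij (ae i) (ae j); rewrite /h.
  case: (tnth alpha i) (tnth alpha j) => [a|] [a'|] //=.
  + by move/invr_inj/addIr->.
  + by move/eqP; rewrite invr_eq0 => ae0 /(_ _ erefl); rewrite ae0.
  + by move/esym/eqP; rewrite invr_eq0 => ae0 _ /(_ _ erefl); rewrite ae0.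
- rewrite mulf_neq0 // /u.
  case E : (tnth alpha i) => [a|]; last exact: oner_neq0.
  by rewrite expf_neq0 ?(ae i).
rewrite mem_cauchy_code //; split=> -[Q szQ ->].
  pose S := Q \Po ('X + e%:P).
  have szS : (size S <= k)%N by rewrite size_comp_poly2 ?size_XaddC.
  exists (rev_poly k.-1 S).
    by rewrite -[X in (_ <= X)%N](prednK k_gt0) size_poly.
  apply/rowP=> i; rewrite !mxE -mulrA evalE // /S -comp_polyA.
  rewrite comp_polyD comp_polyX comp_polyC -addrA -polyCD addNr addr0.
  by rewrite comp_polyXr.
exists (rev_poly k.-1 Q \Po ('X + (- e)%:P)).
  rewrite size_comp_poly2 ?size_XaddC // -[X in (_ <= X)%N](prednK k_gt0).
  exact: size_poly.
apply/rowP=> i; rewrite !mxE -evalE.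
  by rewrite rev_polyK ?prednK // mulrA.
by rewrite -[X in (_ <= X)%N](prednK k_gt0) size_poly.
Qed.

End CauchyCodes.

(** * Permutation equivalence and the two implications *)

Lemma mulmx_perm_row (R : pzSemiRingType) n (c : 'rV[R]_n) (s : 'S_n) :
  c *m perm_mx s = \row_i c 0 (s^-1%g i).
Proof.
by rewrite -[s in LHS]invgK -col_permE; apply/rowP=> i; rewrite !mxE.
Qed.

(** Permuting coordinates relabels locations and multipliers and leaves the polynomials alone. *)
Lemma perm_equivalent_grs (F : finFieldType) k n (C D : {vspace 'rV[F]_n}) b v :
    is_grs k D b v ->
  perm_equivalent C D <-> exists s : 'S_n, is_grs k C (b \o s) (v \o s).
Proof.
move=> D_grs; split=> -[s].
  move=> defD; exists s => c.
  have -> : c \in C <-> c *m perm_mx s \in D.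
    rewrite -defD; split=> [Cc|/memv_imgP[c' Cc']].
      by have := memv_img (linfun (mulmxr (perm_mx s))) Cc; rewrite lfunE.
    by rewrite lfunE /= => /(can_inj (mulmxK (unitmx_perm _ _)))->.
  rewrite D_grs mulmx_perm_row; split=> -[Q szQ defc]; exists Q => //.
    by apply/rowP=> i; move/rowP/(_ (s i)): defc; rewrite !mxE /= permK.
  by apply/rowP=> i; rewrite defc !mxE /= permKV.
move=> C_grs; exists s; apply/vspaceP=> d.
apply/idP/idP=> [/memv_imgP[c /C_grs[Q szQ ->] ->]|/D_grs[Q szQ ->]].
  rewrite lfunE /= mulmx_perm_row D_grs; exists Q => //.
  by apply/rowP=> i; rewrite !mxE /= permKV.
apply/memv_imgP; exists (\row_i (v (s i) * Q.[b (s i)])).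
  by apply/C_grs; exists Q.
by rewrite lfunE /= mulmx_perm_row; apply/rowP=> i; rewrite !mxE permKV.
Qed.

Lemma ext_rs_code_grs (F : finFieldType) k n (xi : F) :
    (0 < k)%N -> n.-1.-primitive_root xi ->
  exists2 b, injective b & is_grs k (ext_rs_code k n xi) b (fun=> 1).
Proof.
move=> k_gt0 xi_prim.
pose b (i : 'I_n) := if (i < n.-1)%N then xi ^+ i else 0; exists b.
  have xi0 : xi != 0.
    apply: contra_eq_neq (prim_expr_order xi_prim) => ->.
    by rewrite expr0n gtn_eqF ?(prim_order_gt0 xi_prim) // eq_sym oner_neq0.
  move=> i j; rewrite /b; case: ltnP => i_n; case: ltnP => j_n.
  - move/eqP; rewrite (eq_prim_root_expr xi_prim) !modn_small // => /eqP.
    exact: val_inj.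
  - by move/eqP; rewrite expf_eq0 (negPf xi0) andbF.
  - by move/esym/eqP; rewrite expf_eq0 (negPf xi0) andbF.
  - by move=> _; apply: val_inj => /=; move: (ltn_ord i) (ltn_ord j); lia.
move=> c; rewrite mem_cauchy_code //.
split=> -[Q szQ ->]; exists Q => //;
  by apply/rowP=> i; rewrite !mxE tnth_mktuple.
Qed.

(** Elementary abelian p-groups of equal order are isomorphic, so [G] is identified with the
    additive group of [F], and position [i] with its location [b i]. Left multiplication becomes a
    translation, which keeps the size of polynomials. *)
Lemma grs_left_group_code (F : finFieldType) k p n (C : {vspace 'rV[F]_n}) b
    (gT : finGroupType) (G : {group gT}) :
    injective b -> n = #|F| -> is_grs k C b (fun=> 1) ->
    p \in [pchar F] -> (p.-abelem G)%g -> #|G| = n ->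
  left_group_code G C.
Proof.
move=> b_inj nF C_grs pF abG cardG.
have /isogP[f injf defG] : ([set: F] \isog G)%g.
  rewrite (isog_abelem_card _ (fin_ring_pchar_abelem pF)) abG.
  by rewrite cardsT cardG nF /=.
have f_inj : injective f by move=> x y; apply: (injmP injf); rewrite inE.
have [a0 _ bK] : bijective b by apply: inj_card_bij; rewrite // card_ord nF.
apply/left_group_codeP; exists (fun i => f (b i)); split.
- by move=> i j /f_inj/b_inj.
- rewrite -defG morphimEdom; apply/setP=> g; apply/imsetP/imsetP=> -[x _ ->].
    by exists (b x); rewrite ?inE.
  by exists (a0 x); rewrite // bK.
move=> g s; rewrite -defG morphimEdom => /imsetP[a _ ->] sE c /C_grs[Q szQ ->].
apply/C_grs; exists (Q \Po ('X + a%:P)).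
  by rewrite size_comp_poly2 ?size_XaddC.
apply/rowP=> i; rewrite !mxE horner_comp !hornerE; congr _.[_].
by apply: f_inj; rewrite sE -morphM ?inE // zmodMgE addrC.
Qed.

Lemma left_group_code_grs (F : finFieldType) k p n (C : {vspace 'rV[F]_n}) b v
    (gT : finGroupType) (G : {group gT}) :
    prime p -> p \in [pchar F] -> (2 <= k <= n - 2)%N -> n = #|F| ->
    injective b -> (forall i, v i != 0) -> is_grs k C b v ->
    #|G| = n -> left_group_code G C ->
  (p.-abelem G)%g /\ is_grs k C b (fun=> 1).
Proof.
move=> p_pr pF k_bounds nF b_inj v0 C_grs cardG.
case/left_group_codeP=> phi [phi_inj defG autC].
have [a bK aK] : bijective b by apply: inj_card_bij; rewrite // card_ord nF.
have phiG i : phi i \in G by rewrite -defG imset_f.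
(* [r] inverts [phi] on [G]; outside [G] the value [a 0] is only a default. *)
have /fin_all_exists[r rE] g : exists i, g \in G -> phi i = g.
  case: (boolP (g \in G)) => [|_]; last by exists (a 0).
  by rewrite -defG => /imsetP[i _ ->]; exists i.
pose s g i := r (g * phi i)%g.
have sE g i : g \in G -> phi (s g i) = (g * phi i)%g.
  by move=> Gg; rewrite rE ?groupM.
(* The action of [G] on positions is transported along [b] to an action on locations, with
   multipliers [v \o a]. *)
have [|||||||abG w_const] := @grs_aut_regular F k p (v \o a) gT G
    (fun g x => b (s g (a x))) p_pr pF.
- by rewrite -nF.
- by move=> x; apply: v0.
- by rewrite cardG.
- move=> g h Gg Gh x; congr b; apply: phi_inj; rewrite bK.
  by rewrite !sE ?groupM // mulgA.
- by move=> x; rewrite -[RHS]aK; congr b; apply: phi_inj; rewrite sE // mul1g.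
- move=> g h Gg Gh /b_inj/(congr1 phi); rewrite !sE //; exact: mulIg.
- move=> g Gg Q szQ.
  have /C_grs[Q' szQ' defQ'] := autC g (s g) Gg (fun i => sE g i Gg)
    (\row_i (v i * Q.[b i])) ((C_grs _).2 (ex_intro2 _ _ Q szQ erefl)).
  exists Q' => // x; move/rowP/(_ (a x)): defQ'.
  by rewrite !mxE /= bK aK.
split=> // c.
have vE i : v i = v (a 0) by have := w_const (b i) 0; rewrite /= bK.
(* A constant nonzero multiplier is absorbed by rescaling [Q]. *)
rewrite C_grs; split=> -[Q szQ ->].
  exists (v (a 0) *: Q); first exact: leq_trans (size_scale_leq _ _) szQ.
  by apply/rowP=> i; rewrite !mxE vE hornerZ mul1r.
exists ((v (a 0))^-1 *: Q); first exact: leq_trans (size_scale_leq _ _) szQ.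
by apply/rowP=> i; rewrite !mxE vE hornerZ mulVKf // mul1r.
Qed.

Unset Implicit Arguments.

Theorem theorem4p6 (p m q k : nat) (F : finFieldType)
    (p_prime : prime p) (m_gt0 : (0 < m)%N) (q_def : q = (p ^ m)%N)
    (card_F : #|F| = q)
    (xi : F) (xi_prim : (q.-1).-primitive_root xi)
    (k_bounds : (2 <= k <= q - 2)%N)
    (C : {vspace 'rV[F]_q}) (C_cauchy : is_cauchy_code k C)
    (gT : finGroupType) (G : {group gT}) (card_G : #|G| = q) :
  left_group_code G C <->
    (perm_equivalent C (ext_rs_code k q xi) /\ (p.-abelem G)%g).
Proof.
have k_gt0 : (0 < k)%N by lia.
have qF := esym card_F.
have pF : p \in [pchar F].
  by apply: (card_finPcharP (n := m)); rewrite ?card_F.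
have [d d_inj D_grs] := ext_rs_code_grs k_gt0 xi_prim.
rewrite (perm_equivalent_grs C D_grs); split; last first.
  case=> -[s C_grs] abG; apply: (grs_left_group_code _ qF C_grs pF abG card_G).
  exact: inj_comp d_inj perm_inj.
case: C_cauchy => _ [alpha [f [u_alpha f0 defC]]].
have [b [v [b_inj v0]]] := cauchy_code_grs k_gt0 qF u_alpha f0.
rewrite -defC => C_grs LG.
have [abG {}C_grs] :=
  left_group_code_grs p_prime pF k_bounds qF b_inj v0 C_grs card_G LG.
split=> //.
(* Both [b] and [d] enumerate [F] and all multipliers are now 1, so the two codes differ only in the
   order of the locations; [d' \o b] matches the positions. *)
have [d' dK d'K] : bijective d.
  by apply: inj_card_bij; rewrite // card_ord card_F.
have s_inj : injective (d' \o b) by apply: inj_comp (can_inj d'K) b_inj.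
exists (perm s_inj) => c; rewrite C_grs.
split=> -[Q szQ ->]; exists Q => //;
  by apply/rowP=> i; rewrite !mxE /= permE /= d'K.
Qed.
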